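(* Let $X$ and $Y$ be finitely shrinking and finitely zero invariant sequence classes. For every $n\in\mathbb{N}$, the ideal $\Pi_{X_1,\ldots,X_n;Y}$ is symmetric whenever $X_i\in\{X^u,X,X^{\rm fd}\}$ for every $i=1,\ldots,n$, and $X_k=X^u$ for some $k\in\{1,\ldots,n\}$. Moreover, in this case $\Pi_{X_1,\ldots,X_n;Y}=\Pi_{X_1,\ldots,X_n;Y^u}$.
   Context: Banach spaces are over $\mathbb{K}=\mathbb{R}$ or $\mathbb{C}$; $\mathcal{L}(E_1,\ldots,E_n;F)$ is the space of continuous $n$-linear operators. $c_{00}(E)$ and $\ell_\infty(E)$ are the spaces of eventually null and of bounded $E$-valued sequences (the latter with the sup norm). $E\stackrel{1}{\hookrightarrow}F$ means that $E$ is a linear subspace of $F$ and $\|\cdot\|_F\le\|\cdot\|_E$ on $E$. $(x_j)_{j=1}^k$ also denotes the sequence $(x_1,\ldots,x_k,0,0,\ldots)$, and $(x_j)_{j\ne k}:=(x_1,\ldots,x_{k-1},x_{k+1},\ldots)$. Sequence class: a rule $X$ assigning to each Banach space $E$ a Banach space $X(E)$ of $E$-valued sequences such that $c_{00}(E)\subseteq X(E)\stackrel{1}{\hookrightarrow}\ell_\infty(E)$ and $\|e_j\|_{X(\mathbb{K})}=1$ for every $j\in\mathbb{N}$, where $e_j$ is the $j$-th canonical unit scalar sequence. Given sequence classes $X_1,\ldots,X_n,Y$, an operator $A\in\mathcal{L}(E_1,\ldots,E_n;F)$ is $(X_1,\ldots,X_n;Y)$-summing, written $A\in\Pi_{X_1,\ldots,X_n;Y}(E_1,\ldots,E_n;F)$,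 if $(A(x_j^1,\ldots,x_j^n))_{j=1}^\infty\in Y(F)$ whenever $(x_j^k)_{j=1}^\infty\in X_k(E_k)$, $k=1,\ldots,n$. Its norm is the norm of the induced continuous $n$-linear operator $X_1(E_1)\times\cdots\times X_n(E_n)\to Y(F)$. Equality of two such classes means equality of the components for all Banach spaces $E_1,\ldots,E_n,F$. Standing assumptions: every sequence class $X$ is linearly stable, i.e. $\Pi_{X;X}(E;F)=\mathcal{L}(E;F)$ with equal norms for all Banach spaces $E,F$; and whenever $\Pi_{X_1,\ldots,X_n;Y}$ is considered, it is assumed that $(\lambda_j^1\cdots\lambda_j^n)_{j}\in Y(\mathbb{K})$ and $\|(\lambda_j^1\cdots\lambda_j^n)_{j}\|_{Y(\mathbb{K})}\le\prod_{k=1}^n\|(\lambda_j^k)_{j}\|_{X_k(\mathbb{K})}$ for all $(\lambda_j^k)_{j}\in X_k(\mathbb{K})$, $k=1,\ldots,n$ (so that $\Pi_{X_1,\ldots,X_n;Y}$ is a Banach ideal of $n$-linear operators). $\Pi_{X_1,\ldots,X_n;Y}$ is symmetric if, for all Banach spaces $E,F$ and every $A\in\Pi_{X_1,\ldots,X_n;Y}(E,\ldots,E;F)$, the symmetrization $A_s(x_1,\ldots,x_n)=\frac1{n!}\sum_{\sigma\in S_n}A(x_{\sigma(1)},\ldots,x_{\sigma(n)})$ belongs to $\Pi_{X_1,\ldots,X_n;Y}(E,\ldots,E;F)$. $X$ is finitely shrinking if, for every $E$, $(x_j)_{j=1}^\infty\in X(E)$ and $k\in\mathbb{N}$, $(x_j)_{j\ne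 k}\in X(E)$ and $\|(x_j)_{j\ne k}\|_{X(E)}\le\|(x_j)_{j=1}^\infty\|_{X(E)}$. $X$ is finitely zero invariant if, for all $E$, all sequences $(x_j)_{j=1}^\infty$ in $E$ and all $k\in\mathbb{N}$ for which $x_k=0$: $(x_j)_{j=1}^\infty\in X(E)$ if and only if $(x_j)_{j\ne k}\in X(E)$, and in this case $\|(x_j)_{j=1}^\infty\|_{X(E)}=\|(x_j)_{j\ne k}\|_{X(E)}$. For $X$ finitely shrinking, $X^u(E)=\{(x_j)_{j=1}^\infty\in X(E):\lim_n\|(x_n,x_{n+1},\ldots)\|_{X(E)}=0\}$ with the norm $\|\cdot\|_{X(E)}$. For any sequence class $X$, $X^{\rm fd}(E):=\{(x_j)_{j=1}^\infty\in E^{\mathbb{N}}:\|(x_j)_{j=1}^\infty\|_{X^{\rm fd}(E)}:=\sup_k\|(x_j)_{j=1}^k\|_{X(E)}<\infty\}$. Both $X^u$ and $X^{\rm fd}$ are (linearly stable) sequence classes. *)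

(* Defs.v *)
From HB Require Import structures.
From mathcomp Require Import all_boot all_order all_algebra all_fingroup.
From mathcomp Require Import complex.
From mathcomp Require Import all_classical all_reals all_analysis.
From mathcomp Require Import lra.

Set Implicit Arguments.
Unset Strict Implicit.
Unset Printing Implicit Defensive.

Import Order.TTheory GRing.Theory Num.Theory.
Import numFieldNormedType.Exports.

Local Open Scope classical_set_scope.
Local Open Scope ring_scope.

Variant scalar_kind := RealScalars | ComplexScalars.

Definition scalar_field (R : realType) (s : scalar_kind) : numFieldType :=
  match s with RealScalars => R | ComplexScalars => R[i] end.

Definition scalar_re (R : realType) (s : scalar_kind) : scalar_field R s -> R :=
  match s return scalar_field R s -> R with
  | RealScalars => id
  | ComplexScalars => @complex.Re R
  end.

Lemma complex_complete (R : realType) (F : set_system (R[i])^o) :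
  ProperFilter F -> cauchy F -> cvg F.
Proof.
move=> FF /cauchy_ballP Fc.
have part_cvg (f : R[i] -> R) : (forall x y, `|f x - f y|%:C%C <= `|x - y|) ->
    cvg (f @ F).
  move=> fle; apply: R_complete; apply/cauchy_ballP => e e0.
  have e0C : 0 < e%:C%C :> R[i] by rewrite ltcR.
  have := Fc _ e0C; rewrite !near2E => -[[A B] /= [FA FB] sAB].
  exists (f @` A, f @` B); first split => /=.
  - by apply: filterS FA => x Ax; exists x.
  - by apply: filterS FB => x Bx; exists x.
  move=> [_ _] /= [[x Ax <-] [y By <-]].
  have := sAB (x, y) (conj Ax By); rewrite /ball /= => xye.
  by rewrite -ltcR; apply: le_lt_trans xye.
have re_cvg : cvg ((@complex.Re R) @ F).
  by apply: part_cvg => -[a b] [c d]; exact: (normc_ge_Re (Complex (a - c) (b - d))).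
have im_cvg : cvg ((@complex.Im R) @ F).
  apply: part_cvg => -[a b] [c d].
  rewrite normc_def /= lecR -sqrtr_sqr ler_sqrt ?lerDr ?sqr_ge0//.
  by rewrite addr_ge0 ?sqr_ge0.
apply/cvg_ex; exists (Complex (lim ((@complex.Re R) @ F)) (lim ((@complex.Im R) @ F))).
apply/cvgrPdist_lt => e e0.
have [eI eR] : complex.Im e = 0 /\ 0 < complex.Re e.
  by move: e0; rewrite ltcE /= => /andP[/eqP -> ->].
have e2 : 0 < complex.Re e / 2 by rewrite divr_gt0.
move/cvgrPdist_lt : re_cvg => /(_ _ e2) reN.
move/cvgrPdist_lt : im_cvg => /(_ _ e2) imN.
near=> x.
have Hr : `|lim ((@complex.Re R) @ F) - complex.Re x| < complex.Re e / 2.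
  by near: x.
have Hi : `|lim ((@complex.Im R) @ F) - complex.Im x| < complex.Re e / 2.
  by near: x.
move: Hr Hi; set a := lim _; set b := lim _.
have -> : Complex a b - x = Complex (a - complex.Re x) (b - complex.Im x).
  by case: (x).
move=> Hr Hi.
have -> : e = (complex.Re e)%:C%C by case: (e) eI => ? ? /= ->.
rewrite normc_def /= ltcR.
rewrite -(ger0_norm (ltW eR)) -sqrtr_sqr ltr_sqrt ?exprn_gt0//.
set p := (a - _) in Hr *; set q := (b - _) in Hi *.
have Hp : p ^+ 2 < (complex.Re e / 2) ^+ 2.
  by rewrite -real_normK ?num_real// ltr_pXn2r ?nnegrE ?normr_ge0 ?ltW.
have Hq : q ^+ 2 < (complex.Re e / 2) ^+ 2.
  by rewrite -real_normK ?num_real// ltr_pXn2r ?nnegrE ?normr_ge0 ?ltW.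
apply: lt_le_trans (ltrD Hp Hq) _.
have := sqr_ge0 (complex.Re e); rewrite expr_div_n; lra.
Unshelve. all: by end_near. Qed.

Lemma scalar_complete (R : realType) (s : scalar_kind)
    (F : set_system (scalar_field R s)^o) :
  ProperFilter F -> cauchy F -> cvg F.
Proof. by case: s F => F; [exact: R_complete|exact: complex_complete]. Qed.

Notation banach R s := (completeNormedModType (scalar_field R s)).

Definition scalar_banach (R : realType) (s : scalar_kind) : banach R s :=
  HB.pack_for (banach R s) (scalar_field R s)^o
    (Uniform_isComplete.Build (scalar_field R s)^o (@scalar_complete R s)).

(* Norms of normed modules take values in the scalar field; [rnorm] is the same
   norm as an element of [R]. *)
Definition rnorm (R : realType) (s : scalar_kind)
  (E : normedModType (scalar_field R s)) (x : E) : R := scalar_re `|x|.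

(* Sequences are indexed from 0. [snorm X x] is meaningful for [x] in
   [carrier X E] only. *)
Record seq_rule (R : realType) (s : scalar_kind) := SeqRule {
  carrier : forall E : banach R s, set (nat -> E);
  snorm : forall E : banach R s, (nat -> E) -> R }.
Arguments carrier {R s} _ E _.
Arguments snorm {R s} _ {E} _.

Section SequenceClasses.
Variables (R : realType) (s : scalar_kind).
Local Notation seq_rule := (seq_rule R s).

Definition seq_rule_eq (X Y : seq_rule) : Prop := forall E : banach R s,
  carrier X E = carrier Y E /\
  forall x, carrier X E x -> snorm X x = snorm Y x.

Record banach_seq_space (E : banach R s)
    (V : set (nat -> E)) (N : (nat -> E) -> R) : Prop := {
  bss_0 : V 0;
  bss_lin : forall (a : scalar_field R s) x y, V x -> V y -> V (a *: x + y);
  bss_norm0 : forall x, V x -> N x = 0 -> x = 0;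
  bss_normZ : forall (a : scalar_field R s) x, V x ->
    N (a *: x) = scalar_re `|a| * N x;
  bss_normD : forall x y, V x -> V y -> N (x + y) <= N x + N y;
  bss_complete : forall x : nat -> nat -> E, (forall m, V (x m)) ->
    (forall e : R, 0 < e -> exists M, forall m p,
       (M <= m)%N -> (M <= p)%N -> N (x m - x p) < e) ->
    exists2 y, V y & (fun m => N (x m - y)) @ \oo --> (0 : R) }.

Definition c00 (E : banach R s) : set (nat -> E) :=
  [set x | exists M, forall j, (M <= j)%N -> x j = 0].
Arguments c00 E _ : clear implicits.

Definition linfty : seq_rule := {|
  carrier := fun E => [set x | has_ubound (range (fun j => rnorm (x j)))];
  snorm := fun E x => sup (range (fun j => rnorm (x j))) |}.

Definition unit_seq (j : nat) : nat -> scalar_banach R s :=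
  fun i => ((i == j)%:R : scalar_field R s).

Record seq_class (X : seq_rule) : Prop := {
  sc_banach : forall E : banach R s,
    banach_seq_space (carrier X E) (snorm X (E := E));
  sc_c00 : forall E : banach R s, c00 E `<=` carrier X E;
  sc_linfty : forall E : banach R s, carrier X E `<=` carrier linfty E;
  sc_linfty_norm : forall (E : banach R s) (x : nat -> E), carrier X E x ->
    snorm linfty x <= snorm X x;
  sc_unit : forall j, snorm X (unit_seq j) = 1 }.

Section Multilinear.
Variables (n : nat) (E : 'I_n -> banach R s) (F : banach R s).
Implicit Type A : (forall i, E i) -> F.

Definition multilinear A : Prop :=
  forall (x : forall i, E i) (i : 'I_n) (a : scalar_field R s) (u v : E i),
    A (dfwith x i (a *: u + v)) =
    a *: A (dfwith x i u) + A (dfwith x i v).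

Definition cont_multilinear : set ((forall i, E i) -> F) :=
  [set A | multilinear A /\ continuous (A : prod_topology E -> F)].

Definition multilinear_norm A : \bar R :=
  ereal_sup [set (rnorm (A x))%:E |
             x in [set x : forall i, E i | forall i, rnorm (x i) <= 1]].

Variables (Xs : 'I_n -> seq_rule) (Y : seq_rule).

Definition seq_apply A (x : forall i, nat -> E i) : nat -> F :=
  fun j => A (fun i => x i j).

Definition summing : set ((forall i, E i) -> F) :=
  [set A | cont_multilinear A /\
    forall x : forall i, nat -> E i, (forall i, carrier (Xs i) (E i) (x i)) ->
      carrier Y F (seq_apply A x)].

(* Norm of the induced map X_1(E_1) x ... x X_n(E_n) -> Y(F). *)
Definition summing_norm A : \bar R :=
  ereal_sup [set (snorm Y (seq_apply A x))%:E |
             x in [set x : forall i, nat -> E i |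
               forall i, carrier (Xs i) (E i) (x i) /\
                         snorm (Xs i) (x i) <= 1]].

End Multilinear.
Arguments cont_multilinear [n] E F _.
Arguments summing [n] E F Xs Y _.

Definition linearly_stable (X : seq_rule) : Prop :=
  forall (E : 'I_1 -> banach R s) (F : banach R s),
    summing E F (fun=> X) X = cont_multilinear E F /\
    forall A, cont_multilinear E F A ->
      summing_norm (fun=> X) X A = multilinear_norm A.

Definition compatible n (Xs : 'I_n -> seq_rule) (Y : seq_rule) : Prop :=
  forall l : 'I_n -> nat -> scalar_banach R s,
    (forall i, carrier (Xs i) (scalar_banach R s) (l i)) ->
    let p : nat -> scalar_banach R s :=
      fun j => \prod_(i < n) (l i j : scalar_field R s) in
    carrier Y (scalar_banach R s) p /\
    snorm Y p <= \prod_(i < n) snorm (Xs i) (l i).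

Definition symmetrization n (E F : banach R s) (A : ('I_n -> E) -> F) :
    ('I_n -> E) -> F :=
  fun x => ((n`!)%:R : scalar_field R s)^-1 *:
    \sum_(sigma : 'S_n) A (fun i => x (sigma i)).

Definition symmetric_summing n (Xs : 'I_n -> seq_rule) (Y : seq_rule) : Prop :=
  forall (E F : banach R s) (A : ('I_n -> E) -> F),
    summing (fun=> E) F Xs Y A ->
    summing (fun=> E) F Xs Y (symmetrization A).

(* [bump k j] is [j.+1] if [k <= j] and [j] otherwise. *)
Definition omit (T : Type) (k : nat) (x : nat -> T) : nat -> T :=
  fun j => x (bump k j).

Definition finitely_shrinking (X : seq_rule) : Prop :=
  forall (E : banach R s) (x : nat -> E) (k : nat), carrier X E x ->
    carrier X E (omit k x) /\ snorm X (omit k x) <= snorm X x.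

Definition finitely_zero_invariant (X : seq_rule) : Prop :=
  forall (E : banach R s) (x : nat -> E) (k : nat), x k = 0 ->
    (carrier X E x <-> carrier X E (omit k x)) /\
    (carrier X E x -> snorm X x = snorm X (omit k x)).

(* X^u. The tails stay in [carrier X E] when X is finitely shrinking. *)
Definition unif (X : seq_rule) : seq_rule := {|
  carrier := fun E => [set x | carrier X E x /\
    (fun m => snorm X (fun j => x (m + j)%N)) @ \oo --> (0 : R)];
  snorm := @snorm R s X |}.

Definition truncate (E : banach R s) (k : nat) (x : nat -> E) : nat -> E :=
  fun j => if (j < k)%N then x j else 0.

(* X^fd. Truncations lie in [c00 E], hence in [carrier X E] for a sequence
   class X. *)
Definition fdet (X : seq_rule) : seq_rule := {|
  carrier := fun E =>
    [set x | has_ubound (range (fun k => snorm X (truncate k x)))];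
  snorm := fun E x => sup (range (fun k => snorm X (truncate k x))) |}.

End SequenceClasses.
Arguments c00 {R s} E _.
Arguments cont_multilinear {R s} [n] E F _.
Arguments summing {R s} [n] E F Xs Y _.

(* Main.v *)
Require Import Defs.
From mathcomp Require Import all_boot all_order all_algebra all_fingroup.
From mathcomp Require Import complex.
From mathcomp Require Import all_classical all_reals all_analysis.
From mathcomp Require Import lra.

Set Implicit Arguments.
Unset Strict Implicit.
Unset Printing Implicit Defensive.

Import Order.TTheory GRing.Theory Num.Theory.
Import numFieldNormedType.Exports.

Local Open Scope classical_set_scope.
Local Open Scope ring_scope.

(** The two conclusions come from one fact: an operator [A] that sends
    sequences of [X^u] (one in each variable) to sequences of [Y] sends
    sequences of [X^fd] to [Y^u] as soon as one of them, in whatever variable,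
    lies in [X^u].  Since [X^u], [X] and [X^fd] all lie between [X^u] and
    [X^fd], the hypothesis on [A] follows from summability for the [X_i], and
    the conclusion no longer remembers which variable carries which class.
    Permuting the variables therefore preserves summability, which gives the
    symmetry, and the target [Y] can be replaced with [Y^u].

    The fact has two halves.

    - A uniform estimate on finite sequences
      ([seq_apply_c00_estimate]): the [Y]-norm of [A] evaluated along finite
      sequences is at most [C] times the product of their [X]-norms.  It is a
      gliding hump: if it failed, one could choose finite sequences in the unit
      balls on which [A] is as large as desired, damp the [m]-th of them by
      [2^-m] and place them in disjoint blocks of [nat].  The resulting series
      converges in [X^u] ([unif_sum_of_blocks]), so [A] maps it into [Y], yet
      the blocks of its image are unbounded.

    - A Cauchy argument ([seq_apply_fdet_unif]): on a block [M, p) the image of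
      [x] is the image of the blocks of the [x_i]; those are bounded by the
      [X^fd]-norms, and the one in [X^u] is small for large [M].  So the
      truncations of the image are Cauchy in [Y], and a sequence whose
      truncations are Cauchy belongs to [Y^u] ([unif_of_small_blocks]).

    Finite shrinking and finite zero invariance enter through cutting: zeroing
    the first [m] terms is contractive, because it amounts to deleting them and
    inserting [m] zeros, hence truncation, its complement, has norm at most 2.
    In particular [X] is contained in [X^fd]. *)

(** * Scalars *)

(** Real numbers are used to rescale vectors over either scalar field, so that
    norms, which are real, can be divided out. *)
Definition real_scalar (R : realType) (s : scalar_kind) : R -> scalar_field R s :=
  match s return R -> scalar_field R s with
  | RealScalars => id
  | ComplexScalars => fun r => r%:C%C
  end.

Section Scalars.
Variables (R : realType) (s : scalar_kind).

Lemma real_scalarM (a b : R) :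
  real_scalar s (a * b) = real_scalar s a * real_scalar s b.
Proof. by case: s => //=; rewrite rmorphM. Qed.

Lemma real_scalar1 : real_scalar s 1 = 1 :> scalar_field R s.
Proof. by case: s. Qed.

Lemma real_scalar0 : real_scalar s 0 = 0 :> scalar_field R s.
Proof. by case: s. Qed.

Lemma real_scalar_prod (I : finType) (a : I -> R) :
  \prod_i real_scalar s (a i) = real_scalar s (\prod_i a i).
Proof.
by rewrite (big_morph (real_scalar s) real_scalarM real_scalar1).
Qed.

Lemma scalar_re_norm_real (a : R) : scalar_re `|real_scalar s a| = `|a|.
Proof. by case: s => //=; rewrite expr0n /= addr0 sqrtr_sqr. Qed.

Lemma scalar_re_ge0 (a : scalar_field R s) : 0 <= a -> 0 <= scalar_re a.
Proof. by case: s a => //= -[a b]; rewrite lecE /= => /andP[]. Qed.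

Lemma scalar_re_eq0 (a : scalar_field R s) : 0 <= a -> scalar_re a = 0 -> a = 0.
Proof.
by case: s a => //= -[a b]; rewrite lecE /= => /andP[/eqP -> _] ->.
Qed.

Lemma rnorm_eq0 (E : banach R s) (x : E) : rnorm x = 0 -> x = 0.
Proof. by move=> x0; apply/normr0_eq0/scalar_re_eq0. Qed.

Lemma rnorm_ge0 (E : banach R s) (x : E) : 0 <= rnorm x.
Proof. exact: scalar_re_ge0. Qed.

End Scalars.

(** * Norms of sequence classes *)

Section SeqClass.
Variables (R : realType) (s : scalar_kind) (X : seq_rule R s).
Hypothesis Xc : seq_class X.
Variable E : banach R s.
Implicit Types x y : nat -> E.

Let bss := sc_banach Xc E.

Lemma carrier0 : carrier X E (0 : nat -> E).
Proof. exact: bss_0 bss. Qed.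

Lemma carrierD x y : carrier X E x -> carrier X E y -> carrier X E (x + y).
Proof. by move=> cx cy; rewrite -[x]scale1r; exact: bss_lin bss _ _ _ cx cy. Qed.

Lemma carrierZ (a : scalar_field R s) x : carrier X E x -> carrier X E (a *: x).
Proof.
by move=> cx; rewrite -[_ *: _]addr0; exact: bss_lin bss _ _ _ cx carrier0.
Qed.

Lemma carrierB x y : carrier X E x -> carrier X E y -> carrier X E (x - y).
Proof. by move=> cx cy; rewrite -scaleN1r; exact/carrierD/carrierZ. Qed.

Lemma snorm0 : snorm X (0 : nat -> E) = 0.
Proof.
by rewrite -(scale0r (0 : nat -> E)) -real_scalar0 (bss_normZ bss _ carrier0)
  scalar_re_norm_real normr0 mul0r.
Qed.

Lemma snormZr (r : R) x : carrier X E x ->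
  snorm X (real_scalar s r *: x) = `|r| * snorm X x.
Proof. by move=> cx; rewrite (bss_normZ bss _ cx) scalar_re_norm_real. Qed.

Lemma snormN x : carrier X E x -> snorm X (- x) = snorm X x.
Proof.
by move=> cx; rewrite -scaleN1r (bss_normZ bss _ cx) normrN -real_scalar1
  scalar_re_norm_real normr1 mul1r.
Qed.

Lemma snormB x y : carrier X E x -> carrier X E y ->
  snorm X (x - y) <= snorm X x + snorm X y.
Proof.
move=> cx cy; rewrite -(snormN cy); apply: (bss_normD bss) => //.
by rewrite -scaleN1r; exact: carrierZ.
Qed.

Lemma carrier_sum (I : Type) (r : seq I) (P : pred I) (f : I -> nat -> E) :
  (forall i, P i -> carrier X E (f i)) -> carrier X E (\sum_(i <- r | P i) f i).
Proof.
by move=> cf; apply: (big_ind (carrier X E)) => //; [exact: carrier0|exact: carrierD].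
Qed.

Lemma snorm_sum (I : Type) (r : seq I) (P : pred I) (f : I -> nat -> E) :
  (forall i, P i -> carrier X E (f i)) ->
  snorm X (\sum_(i <- r | P i) f i) <= \sum_(i <- r | P i) snorm X (f i).
Proof.
move=> cf.
suff : carrier X E (\sum_(i <- r | P i) f i) /\
  snorm X (\sum_(i <- r | P i) f i) <= \sum_(i <- r | P i) snorm X (f i) by case.
apply: (big_ind2 (fun u v => carrier X E u /\ snorm X u <= v)).
- by rewrite snorm0; split => //; exact: carrier0.
- move=> u a v b [cu ua] [cv vb]; split; first exact: carrierD.
  exact: le_trans (bss_normD bss cu cv) (lerD ua vb).
- by move=> i Pi; split => //; exact: cf.
Qed.

Lemma rnorm_le_snorm x j : carrier X E x -> rnorm (x j) <= snorm X x.
Proof.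
move=> cx; apply: le_trans (sc_linfty_norm Xc cx).
by apply: ub_le_sup; [exact: (@sc_linfty _ _ _ Xc E x cx)|exists j].
Qed.

End SeqClass.

(** * Shifting and cutting sequences *)

Section Shifts.
Variable (T : nmodType).
Implicit Types x y : nat -> T.

Definition shift (m : nat) x : nat -> T := fun j => x (m + j)%N.
Definition prepend (m : nat) x : nat -> T :=
  fun j => if (j < m)%N then 0 else x (j - m)%N.
Definition drop_head (m : nat) x : nat -> T :=
  fun j => if (j < m)%N then 0 else x j.

Lemma shiftS m x : shift m.+1 x = omit 0 (shift m x).
Proof. by apply/funext => j; rewrite /shift /omit /bump /= addnA addn1. Qed.

Lemma omit_prepend m x : omit 0 (prepend m.+1 x) = prepend m x.
Proof. by apply/funext => j; rewrite /prepend /omit /bump /= add1n ltnS subSS. Qed.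

Lemma prepend0 x : prepend 0 x = x.
Proof. by apply/funext => j; rewrite /prepend subn0. Qed.

Lemma drop_headE m x : drop_head m x = prepend m (shift m x).
Proof.
by apply/funext => j; rewrite /drop_head /prepend /shift; case: ltnP => // /subnKC ->.
Qed.

End Shifts.

Section Truncations.
Variables (R : realType) (s : scalar_kind) (E : banach R s).
Implicit Types x y : nat -> E.

Lemma truncate_c00 m x : c00 E (truncate m x).
Proof. by exists m => j mj; rewrite /truncate ltnNge mj. Qed.

Lemma truncate_drop_head m x : truncate m x + drop_head m x = x.
Proof.
apply/funext => j; rewrite /truncate /drop_head /GRing.add /=.
by case: ifP; rewrite ?addr0 ?add0r.
Qed.

Lemma drop_headB m x : x - truncate m x = drop_head m x.
Proof. by rewrite -{1}(truncate_drop_head m x) addrC addKr. Qed.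

Lemma truncateB m x : x - drop_head m x = truncate m x.
Proof. by rewrite -{1}(truncate_drop_head m x) addrK. Qed.

Lemma truncate_drop_headC m p x :
  truncate p (drop_head m x) = drop_head m (truncate p x).
Proof.
by apply/funext => j; rewrite /truncate /drop_head; case: ifP; case: ifP.
Qed.

End Truncations.

Lemma sum_half_le (R : realFieldType) (m p : nat) :
  \sum_(m <= k < p) (2^-1) ^+ k <= 2 * (2^-1) ^+ m :> R.
Proof.
have [h0 h2] : 0 <= 2^-1 :> R /\ 2^-1 * 2 = 1 :> R by rewrite invr_ge0 ler0n mulVf.
move: (2^-1) h0 h2 => h h0 h2; have hX k : 0 <= h ^+ k by exact: exprn_ge0.
have [mp|pm] := leqP m p; last first.
  by rewrite big_geq; [rewrite mulr_ge0|exact: ltnW].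
(* [h ^+ k = 2 * h ^+ k - 2 * h ^+ k.+1] telescopes. *)
have -> : \sum_(m <= k < p) h ^+ k =
    \sum_(m <= k < p) (- 2 * h ^+ k.+1 - - 2 * h ^+ k).
  by apply: eq_bigr => k _; rewrite exprS; move: (h ^+ k) => x; nra.
by rewrite telescope_sumr//; have := hX p; lra.
Qed.

(** * Cutting in finitely shrinking, finitely zero invariant classes *)

Section Shrinking.
Variables (R : realType) (s : scalar_kind) (X : seq_rule R s).
Hypotheses (Xc : seq_class X) (Xs : finitely_shrinking X)
  (Xz : finitely_zero_invariant X).
Variable E : banach R s.
Implicit Types x y : nat -> E.

Lemma carrier_shift m x : carrier X E x -> carrier X E (shift m x).
Proof.
move=> cx; elim: m => [//|m IH].
by rewrite shiftS; have [] := Xs 0 IH.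
Qed.

Lemma snorm_shift_le m p x : (m <= p)%N -> carrier X E x ->
  snorm X (shift p x) <= snorm X (shift m x).
Proof.
move=> + cx; elim: p => [|p IH]; first by rewrite leqn0 => /eqP ->.
rewrite leq_eqVlt => /orP[/eqP -> //|]; rewrite ltnS => /IH; apply: le_trans.
by rewrite shiftS; have [] := Xs 0 (carrier_shift p cx).
Qed.

Lemma carrier_prepend m x : carrier X E x -> carrier X E (prepend m x).
Proof.
move=> cx; elim: m => [|m IH]; first by rewrite prepend0.
by have [/iffRL + _] := @Xz E (prepend m.+1 x) 0 erefl; apply; rewrite omit_prepend.
Qed.

Lemma snorm_prepend m x : carrier X E x -> snorm X (prepend m x) = snorm X x.
Proof.
move=> cx; elim: m => [|m IH]; first by rewrite prepend0.
have [_] := @Xz E (prepend m.+1 x) 0 erefl; rewrite omit_prepend IH; apply.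
exact: carrier_prepend.
Qed.

Lemma carrier_drop_head m x : carrier X E x -> carrier X E (drop_head m x).
Proof. by move=> cx; rewrite drop_headE; exact/carrier_prepend/carrier_shift. Qed.

Lemma snorm_drop_head m x : carrier X E x ->
  snorm X (drop_head m x) = snorm X (shift m x).
Proof. by move=> cx; rewrite drop_headE snorm_prepend//; exact: carrier_shift. Qed.

(** Zeroing a head is deleting it, a contraction by finite shrinking, and then
    inserting zeros, an isometry by finite zero invariance. *)
Lemma snorm_drop_head_le m x : carrier X E x ->
  snorm X (drop_head m x) <= snorm X x.
Proof. by move=> cx; rewrite snorm_drop_head//; exact: (@snorm_shift_le 0). Qed.

Lemma carrier_truncate m x : carrier X E (truncate m x).
Proof. exact/(sc_c00 Xc)/truncate_c00. Qed.

(** Truncation deletes infinitely many terms, so shrinking does not bound it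
    directly; it is the complement of a contractive cut, whence the factor 2. *)
Lemma snorm_truncate_le m x : carrier X E x ->
  snorm X (truncate m x) <= 2 * snorm X x.
Proof.
move=> cx; rewrite -truncateB.
apply: le_trans (snormB Xc cx (carrier_drop_head m cx)) _.
by have := snorm_drop_head_le m cx; lra.
Qed.

(** A Cauchy criterion: the truncations of [y] are Cauchy, hence converge in
    [X]. The limit is [y] because the norm dominates each coordinate, and the
    distance from [y] to its truncations is the norm of its tails. *)
Lemma unif_of_small_blocks y :
  (forall e : R, 0 < e -> exists M, forall p,
     snorm X (truncate p (drop_head M y)) <= e) ->
  carrier (unif X) E y.
Proof.
move=> small.
have [|z cz zlim] := bss_complete (sc_banach Xc E) (x := fun m => truncate m y)
    (fun m => carrier_truncate m y).
  move=> e e0; have [M hM] := small (e / 3) (divr_gt0 e0 (ltr0n _ 3)).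
  exists M => m p Mm Mp.
  have trE q : (M <= q)%N ->
      truncate q y = truncate M y + truncate q (drop_head M y).
    move=> Mq; apply/funext => j; rewrite /truncate /drop_head /GRing.add /=.
    by case: ifP => jq; case: ltnP => jM; rewrite ?addr0 ?add0r //;
      move: (leq_trans jM Mq); rewrite jq.
  rewrite (trE m)// (trE p)// opprD addrACA subrr add0r.
  apply: le_lt_trans (snormB Xc (carrier_truncate _ _) (carrier_truncate _ _)) _.
  by move: (hM m) (hM p); lra.
have zy : z = y.
  apply/funext => j; apply/esym/subr0_eq/rnorm_eq0/le_anti.
  (* The truncation at [maxn N j.+1] is close to [z] and agrees with [y] at [j]. *)
  rewrite rnorm_ge0 andbT; apply/ler_addgt0Pl => e e0; rewrite addr0.
  move/cvgrPdist_lt : zlim => /(_ _ e0)[N _ zN].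
  have /zN := leq_maxl N j.+1; rewrite sub0r normrN => /(le_lt_trans (ler_norm _)).
  move=> /ltW; apply: le_trans.
  have := rnorm_le_snorm Xc j (carrierB Xc (carrier_truncate (maxn N j.+1) y) cz).
  by rewrite /truncate /GRing.add /GRing.opp /= leq_maxr.
rewrite {}zy in cz zlim; split => //.
apply/cvgrPdist_lt => e e0; move/cvgrPdist_lt : zlim => /(_ _ e0).
apply: filterS => m; rewrite !sub0r !normrN.
by rewrite -opprB snormN ?drop_headB ?snorm_drop_head//; exact: carrier_drop_head.
Qed.

(** Finite sequences of norm at most 1, placed side by side with weights [2^-m],
    add up to an element of [X^u]: the block of the sum on [P M, p) is the
    truncation of a partial sum of norm at most [2 * 2^-M].  Each [w m] is given
    [(L m).+1] places, so that block [m] starts at [P m >= m] even when the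
    supports are empty; hence the sum at [j] needs no index above [j]. *)
Lemma unif_sum_of_blocks (w : nat -> nat -> E) (L : nat -> nat) :
  (forall m j, (L m <= j)%N -> w m j = 0) ->
  (forall m, snorm X (w m) <= 1) ->
  exists2 y, carrier (unif X) E y &
    forall m j, (j <= L m)%N ->
      y (\sum_(k < m) (L k).+1 + j)%N = real_scalar s (2^-1 ^+ m) *: w m j.
Proof.
move=> w0 w1; pose P m := (\sum_(k < m) (L k).+1)%N.
have PS m : P m.+1 = (P m + (L m).+1)%N by rewrite /P big_ord_recr.
have Pmono m p : (m <= p)%N -> (P m <= P p)%N.
  elim: p => [|p IH]; first by rewrite leqn0 => /eqP ->.
  rewrite leq_eqVlt => /orP[/eqP -> //|]; rewrite ltnS => /IH /leq_trans; apply.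
  by rewrite PS leq_addr.
have Pge m : (m <= P m)%N.
  elim: m => // m IH; rewrite PS addnS ltnS; exact: leq_trans IH (leq_addr _ _).
have cw m : carrier X E (w m) by apply: (sc_c00 Xc); exists (L m) => j; exact: w0.
pose b m : nat -> E := real_scalar s (2^-1 ^+ m) *: prepend (P m) (w m).
have cb m : carrier X E (b m) by exact/(carrierZ Xc)/carrier_prepend.
have b_small m : snorm X (b m) <= 2^-1 ^+ m.
  rewrite snormZr//; last exact: carrier_prepend.
  rewrite snorm_prepend// ger0_norm ?exprn_ge0 ?invr_ge0//.
  by rewrite ler_piMr ?exprn_ge0 ?invr_ge0.
have bl m j : (j < P m)%N -> b m j = 0.
  by move=> jP; rewrite /b /GRing.scale /= /prepend jP scaler0.
have br m j : (P m.+1 <= j)%N -> b m j = 0.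
  move=> Pj; rewrite /b /GRing.scale /= /prepend; case: ifP => _; rewrite ?scaler0//.
  by rewrite w0 ?scaler0// leq_subRL ?(leq_trans _ Pj) ?PS ?leq_add2l ?leq_addr//
    (leq_trans _ Pj)// PS addnS ltnW// ltnS leq_addr.
pose y j := \sum_(0 <= m < j.+1) b m j.
exists y; last first.
  move=> m j jL; rewrite -/(P m) /y.
  have mj : (m < (P m + j).+1)%N by rewrite ltnS (leq_trans (Pge m)) ?leq_addr.
  rewrite big_mkord (bigD1 (Ordinal mj))//= big1 ?addr0.
    by rewrite /b /GRing.scale /= /prepend ltnNge leq_addr addKn.
  move=> [k kj]; rewrite -val_eqE /= neq_ltn => /orP[km|mk].
    by rewrite br// (leq_trans (Pmono _ _ km)) ?leq_addr.
  by rewrite bl// (leq_trans _ (Pmono _ _ mk))// PS addnS ltnS leq_add2l.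
apply: unif_of_small_blocks => // e e0.
have e4 : 0 < e / 4 by rewrite divr_gt0.
have [M _ /(_ _ (leqnn M)) /= hM] := near_infty_natSinv_expn_lt (PosNum e4).
exists (P M) => p.
have -> : truncate p (drop_head (P M) y) = truncate p (\sum_(M <= m < p) b m).
  apply/funext => j; rewrite /truncate; case: ifP => // jp.
  rewrite /drop_head fct_sumE; case: ifP => jM.
    by rewrite big_nat_cond big1// => m /andP[/andP[Mm _] _];
      rewrite bl// (leq_trans jM)// Pmono.
  have {}jM : (P M <= j)%N by rewrite leqNgt jM.
  rewrite /y (@big_cat_nat _ _ _ M)//=; last by rewrite (leq_trans (Pge M)) 1?ltnW.
  rewrite big_nat_cond big1 ?add0r; last first.
    by move=> m /andP[/andP[_ mM] _]; rewrite br// (leq_trans (Pmono _ _ mM)).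
  rewrite [RHS](@big_cat_nat _ _ _ j.+1)//=; last by rewrite leqW// (leq_trans (Pge M)).
  rewrite [X in _ = _ + X]big_nat_cond [X in _ = _ + X]big1 ?addr0//.
  by move=> m /andP[/andP[jm _] _]; rewrite bl// (leq_trans jm).
have cs : carrier X E (\sum_(M <= m < p) b m) by exact: carrier_sum.
apply: le_trans (snorm_truncate_le p cs) _.
have h1 : snorm X (\sum_(M <= m < p) b m) <= 2 * (2^-1) ^+ M.
  apply: le_trans (snorm_sum Xc _ _) _ => //.
  by apply: le_trans (sum_half_le R M p); exact: ler_sum.
by move: hM h1; rewrite div1r exprVn; lra.
Qed.

Lemma unif_small_tail y (e : R) : 0 < e -> carrier (unif X) E y ->
  exists M, snorm X (drop_head M y) <= e.
Proof.
move=> e0 [cy] /cvgrPdist_lt /(_ _ e0) [N _ /(_ N (leqnn N))].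
rewrite sub0r normrN => /(le_lt_trans (ler_norm _)) /ltW Ne.
by exists N; rewrite snorm_drop_head.
Qed.

End Shrinking.

(** * Multilinear maps *)

Section MultilinearMaps.
Variables (R : realType) (s : scalar_kind) (n : nat).
Variables (E : 'I_n -> banach R s) (F : banach R s) (A : (forall i, E i) -> F).
Hypothesis Alin : multilinear A.

Lemma dfwith_same (x : forall i, E i) i : dfwith x i (x i) = x.
Proof. by apply: functional_extensionality_dep => j; case: dfwithP. Qed.

Lemma multilinear_eq0 (x : forall i, E i) i : x i = 0 -> A x = 0.
Proof.
move=> xi0; rewrite -(dfwith_same x i) xi0.
have := @Alin x i 1 0 0; rewrite !scale1r addr0 => /esym/eqP.
by rewrite -subr_eq0 addrK => /eqP.
Qed.

Lemma multilinearZ (x : forall i, E i) (a : 'I_n -> scalar_field R s) :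
  A (fun i => a i *: x i) = (\prod_i a i) *: A x.
Proof.
(* Rescale the coordinates listed in [r] only, and let [r] grow. *)
pose g (r : seq 'I_n) i := if i \in r then a i *: x i else x i.
suff H (r : seq 'I_n) : uniq r -> A (g r) = (\prod_(i <- r) a i) *: A x.
  rewrite -[in RHS]big_enum/= -H ?enum_uniq//; congr A.
  by apply: functional_extensionality_dep => i; rewrite /g mem_enum.
elim: r => [_|i r IH /= /andP[ir /IH {}IH]]; first by rewrite big_nil scale1r.
have -> : g (i :: r) = dfwith (g r) i (a i *: x i + 0).
  apply: functional_extensionality_dep => j; case: dfwithP => [|j' ij].
    by rewrite /g inE eqxx addr0.
  by rewrite /g inE eq_sym (negbTE ij).
rewrite Alin [X in _ + X](@multilinear_eq0 _ i) ?dfwithin// addr0.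
have -> : x i = g r i by rewrite /g (negbTE ir).
by rewrite dfwith_same IH big_cons scalerA.
Qed.

End MultilinearMaps.

(** * The finite estimate and its consequence *)

(** The index [l] makes sure that there is a variable, so that [A] vanishes at 0
    and hence sends finite sequences to finite sequences. *)
Section GlidingHump.
Variables (R : realType) (s : scalar_kind) (X Y : seq_rule R s).
Hypotheses (Xc : seq_class X) (Xs : finitely_shrinking X)
  (Xz : finitely_zero_invariant X).
Hypotheses (Yc : seq_class Y) (Ys : finitely_shrinking Y)
  (Yz : finitely_zero_invariant Y).
Variables (n : nat) (E : 'I_n -> banach R s) (F : banach R s)
  (A : (forall i, E i) -> F) (l : 'I_n).
Hypotheses (Alin : multilinear A)
  (Asum : forall x : forall i, nat -> E i,
     (forall i, carrier (unif X) (E i) (x i)) -> carrier Y F (seq_apply A x)).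
Implicit Types x : forall i, nat -> E i.

Lemma c00_seq_apply x : c00 (E l) (x l) -> c00 F (seq_apply A x).
Proof.
by move=> [M xM]; exists M => j /xM xj; exact: multilinear_eq0 Alin _ _ xj.
Qed.

Lemma truncate_seq_apply m x :
  truncate m (seq_apply A x) = seq_apply A (fun i => truncate m (x i)).
Proof.
apply/funext => j; rewrite /truncate /seq_apply; case: ifP => // _.
by rewrite (multilinear_eq0 Alin (i := l)).
Qed.

Lemma drop_head_seq_apply m x :
  drop_head m (seq_apply A x) = seq_apply A (fun i => drop_head m (x i)).
Proof.
apply/funext => j; rewrite /drop_head /seq_apply; case: ifP => // _.
by rewrite (multilinear_eq0 Alin (i := l)).
Qed.

(** Gliding hump: the blocks [w m] are chosen so that [A] exceeds
    [m * (2^m)^n] on them, which beats the factor [(2^-m)^n] that damping each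
    of the [n] arguments by [2^-m] costs. *)
Lemma seq_apply_bounded_c00 : exists2 C, 0 <= C & forall x,
  (forall i, c00 (E i) (x i)) -> (forall i, snorm X (x i) <= 1) ->
  snorm Y (seq_apply A x) <= C.
Proof.
apply: contrapT => nobd.
have hump m : exists w : (forall i, nat -> E i) * nat,
    [/\ forall i j, (w.2 <= j)%N -> w.1 i j = 0,
        forall i, snorm X (w.1 i) <= 1 &
        m%:R * (2 ^+ m) ^+ n < snorm Y (seq_apply A w.1)].
  apply: contrapT => nw; apply: nobd; exists (m%:R * (2 ^+ m) ^+ n).
    by rewrite mulr_ge0// !exprn_ge0.
  move=> x x00 x1; rewrite leNgt; apply/negP => big; apply: nw.
  have [L hL] := choice x00.
  exists (x, \max_i L i)%N; split => //= i j Lj.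
  by apply: hL; exact: leq_trans (leq_bigmax i) Lj.
have [w hw] := choice hump.
pose P m := (\sum_(k < m) (w k).2.+1)%N.
have ycid : forall i, exists y : nat -> E i, carrier (unif X) (E i) y /\
    forall m j, (j <= (w m).2)%N ->
      y (P m + j)%N = real_scalar s (2^-1 ^+ m) *: (w m).1 i j.
  move=> i; have [|m|y cy yE] := unif_sum_of_blocks Xc Xs Xz (E := E i)
    (w := fun m => (w m).1 i) (L := fun m => (w m).2).
  - by move=> m j; have [+ _ _] := hw m; apply.
  - by have [_ + _] := hw m; apply.
  - by exists y.
have [y hy] := ex_intro (fun y : forall i, nat -> E i => forall i, _ (y i))
  (fun i => projT1 (cid (ycid i))) (fun i => projT2 (cid (ycid i))).
have cA : carrier Y F (seq_apply A y) by apply: Asum => i; have [] := hy i.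
pose m := (Num.trunc (2 * snorm Y (seq_apply A y))).+1.
(* Cutting the image at block [m] recovers the [m]-th hump, and cutting costs
   at most a factor 2; the choice of [m] makes this absurd. *)
have block : truncate (w m).2.+1 (shift (P m) (seq_apply A y)) =
    real_scalar s ((2^-1 ^+ m) ^+ n) *: seq_apply A (w m).1.
  have [w0 _ _] := hw m.
  apply/funext => j; rewrite /truncate /shift /GRing.scale /= /seq_apply.
  case: ltnP => jL; last first.
    by rewrite (multilinear_eq0 Alin (i := l)) ?scaler0// w0// ltnW.
  rewrite -[X in _ ^+ X]card_ord -prodr_const -real_scalar_prod -multilinearZ//.
  congr A; apply: functional_extensionality_dep => i.
  by have [_ ->] := hy i.
have := snorm_truncate_le Yc Ys Yz (w m).2.+1 (carrier_shift Ys (P m) cA).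
have [w0 _ wbig] := hw m.
have cw : carrier Y F (seq_apply A (w m).1).
  by apply: (sc_c00 Yc); apply: c00_seq_apply; exists (w m).2 => j; exact: w0.
rewrite block snormZr// ger0_norm ?exprn_ge0 ?invr_ge0//.
have := @snorm_shift_le _ _ _ Ys _ 0 (P m) _ (leq0n _) cA.
have mbig : 2 * snorm Y (seq_apply A y) < m%:R by exact: truncnS_gt.
move: wbig; rewrite -ltr_pdivlMr ?exprn_gt0// exprVn mulrC exprVn.
change (shift 0 (seq_apply A y)) with (seq_apply A y).
by move: mbig; lra.
Qed.

Lemma seq_apply_c00_estimate : exists2 C, 0 <= C & forall x (K : 'I_n -> R),
  (forall i, c00 (E i) (x i)) -> (forall i, 0 < K i) ->
  (forall i, snorm X (x i) <= K i) ->
  snorm Y (seq_apply A x) <= C * \prod_i K i.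
Proof.
have [C C0 hC] := seq_apply_bounded_c00; exists C => // x K x00 K0 xK.
have cA : carrier Y F (seq_apply A x) by exact/(sc_c00 Yc)/c00_seq_apply.
have := hC (fun i => real_scalar s (K i)^-1 *: x i).
have -> : seq_apply A (fun i => real_scalar s (K i)^-1 *: x i) =
    real_scalar s (\prod_i (K i)^-1) *: seq_apply A x.
  by apply/funext => j; rewrite -real_scalar_prod [RHS](esym (multilinearZ Alin _ _)).
have K0' : 0 < \prod_i K i by exact: prodr_gt0.
rewrite snormZr// prodfV ger0_norm; last by rewrite invr_ge0 ltW.
rewrite mulrC ler_pdivrMr//.
apply => i.
  by have [M xM] := x00 i; exists M => j /xM xj; rewrite /GRing.scale /= xj scaler0.
rewrite (snormZr Xc); last exact: (sc_c00 Xc).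
rewrite ger0_norm; last by rewrite invr_ge0 ltW.
by rewrite mulrC ler_pdivrMr// mul1r.
Qed.

(** The estimate is applied to blocks [M, p): every factor is bounded by the
    [X^fd]-norm except the [l]-th, which is made small by the choice of [M]. *)
Lemma seq_apply_fdet_unif x :
  (forall i, carrier (fdet X) (E i) (x i)) -> carrier (unif X) (E l) (x l) ->
  carrier (unif Y) F (seq_apply A x).
Proof.
move=> xfd xl.
have /choice[K hK] : forall i, exists K : R, 0 < K /\
    forall p, snorm X (truncate p (x i)) <= K.
  move=> i; have [K Kub] := xfd i; exists (Num.max K 1); split.
    by rewrite lt_max ltr01 orbT.
  by move=> p; rewrite le_max Kub//; exists p.
have [C C0 hC] := seq_apply_c00_estimate.
apply: unif_of_small_blocks => // e e0.
(* Block [l] will have norm at most [2 * d]; this [d] makes the bound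
   [C * (2 * d) * Q] at most [e], with [C + 1] in place of [C] to divide by a
   positive number. *)
pose Q := \prod_(i | i != l) K i.
have Q0 : 0 < Q by apply: prodr_gt0 => i _; have [] := hK i.
have CQ0 : 0 < 2 * ((C + 1) * Q) by rewrite !mulr_gt0// ltr_wpDl.
pose d := e / (2 * ((C + 1) * Q)).
have d0 : 0 < d by rewrite divr_gt0.
have [M hM] := unif_small_tail Xs Xz d0 xl.
exists M => p; rewrite drop_head_seq_apply truncate_seq_apply.
pose K' i := if i == l then 2 * d else K i.
apply: le_trans (hC _ K' _ _ _) _ => [i|i|i|].
- exact: truncate_c00.
- by rewrite /K'; case: ifP => _; [rewrite mulr_gt0|have [] := hK i].
- rewrite /K'; case: ifP => [/eqP ->|_].
    apply: le_trans (snorm_truncate_le Xc Xs Xz p _) _.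
      by apply: carrier_drop_head => //; case: xl.
    by rewrite ler_pM2l.
  rewrite truncate_drop_headC; have [_ /(_ p)] := hK i; apply: le_trans.
  by apply: snorm_drop_head_le => //; exact: carrier_truncate.
- rewrite (bigD1 l)//= {1}/K' eqxx.
  have -> : \prod_(i | i != l) K' i = Q.
    by apply: eq_bigr => i /negbTE il; rewrite /K' il.
  have <- : d * (2 * ((C + 1) * Q)) = e by rewrite divfK// gt_eqF.
  have : 0 < d * Q by rewrite mulr_gt0.
  by nra.
Qed.

End GlidingHump.

(** * Symmetrization *)

Lemma reindex_continuous (I : eqType) (T : topologicalType) (h : I -> I) :
  continuous ((fun x => x \o h) :
    prod_topology (fun _ : I => T) -> prod_topology (fun _ : I => T)).
Proof.
move=> x; apply/cvg_sup; first exact/fmap_filter/(nbhs_filter (x : prod_topology (fun=> T))).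
move=> i U [V] [[W oW <-] Wx WU].
have := @proj_continuous I (fun=> T) (h i) x W.
rewrite !nbhs_simpl => /(_ (open_nbhs_nbhs (conj oW Wx))).
by apply: (@filterS _ _ (nbhs_filter (x : prod_topology (fun=> T)))) => y Wy; exact: (WU (y \o h) Wy).
Qed.

Lemma scaled_sum_continuous (K : numFieldType) (V : normedModType K)
    (T : topologicalType) (a : K) (I : Type) (r : seq I) (f : I -> T -> V) :
  (forall i, continuous (f i)) ->
  continuous (fun x => a *: \sum_(i <- r) f i x).
Proof.
move=> fc x; apply: cvgZl_tmp; elim: r => [|i r IH].
  by under eq_fun do rewrite big_nil; rewrite big_nil; exact: cvg_cst.
by under eq_fun do rewrite big_cons; rewrite big_cons; apply: cvgD => //; exact: fc.
Qed.

Section Symmetrization.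
Variables (R : realType) (s : scalar_kind) (n : nat) (E F : banach R s).
Implicit Types (A : ('I_n -> E) -> F) (sigma : 'S_n).

Lemma cont_multilinear_permute A sigma :
  cont_multilinear (fun=> E) F A ->
  cont_multilinear (fun=> E) F (fun x => A (x \o sigma)).
Proof.
move=> [Alin Acont]; split; last first.
  move=> x; apply: (@continuous_comp _ _ _ _ (A : prod_topology (fun _ : 'I_n => E) -> F)).
    exact: reindex_continuous.
  exact: Acont.
move=> x i a u v.
(* Changing argument [i] before permuting is changing argument [sigma^-1 i]
   after permuting. *)
have permE w : dfwith x i w \o sigma =
    dfwith (T := fun=> E) (x \o sigma) ((sigma^-1)%g i) w.
  apply/funext => j /=; case: (dfwithP (x \o sigma)) => [|k ik].
    by rewrite permKV dfwithin.
  by rewrite dfwithout//; apply: contraNneq ik => ->; rewrite permK.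
by rewrite !permE Alin.
Qed.

Lemma cont_multilinear_symmetrization A :
  cont_multilinear (fun=> E) F A ->
  cont_multilinear (fun=> E) F (symmetrization A).
Proof.
move=> cA; split.
  move=> x i a u v; rewrite /symmetrization.
  under eq_bigr => sigma _.
    rewrite (cont_multilinear_permute sigma cA).1; over.
  by rewrite big_split /= -scaler_sumr scalerDr !scalerA [_ * a]mulrC.
apply: (@scaled_sum_continuous _ F (prod_topology (fun _ : 'I_n => E)) _ _ _
  (fun sigma x => A (x \o sigma))) => sigma.
exact: (cont_multilinear_permute sigma cA).2.
Qed.

End Symmetrization.

(** * The three classes lie between X^u and X^fd *)

Section Sandwich.
Variables (R : realType) (s : scalar_kind) (X Z : seq_rule R s).
Hypotheses (Xc : seq_class X) (Xs : finitely_shrinking X)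
  (Xz : finitely_zero_invariant X).
Hypothesis Zch : seq_rule_eq Z (unif X) \/ seq_rule_eq Z X \/
  seq_rule_eq Z (fdet X).
Variables (E : banach R s).

Lemma carrier_fdet : carrier X E `<=` carrier (fdet X) E.
Proof.
move=> x cx; exists (2 * snorm X x) => _ [p _ <-].
exact: snorm_truncate_le.
Qed.

Lemma unif_sub_choice : carrier (unif X) E `<=` carrier Z E.
Proof.
move=> x [cx xlim].
by case: Zch => [/(_ E)[-> _]//|[/(_ E)[-> _]//|/(_ E)[-> _]]]; exact: carrier_fdet.
Qed.

Lemma choice_sub_fdet : carrier Z E `<=` carrier (fdet X) E.
Proof.
move=> x; case: Zch => [/(_ E)[-> _] [cx _]|[/(_ E)[-> _] cx|/(_ E)[-> _]//]];
exact: carrier_fdet.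
Qed.

End Sandwich.

(** * Symmetry and uniform target *)

Theorem theorem5p5 (R : realType) (s : scalar_kind) (X Y : seq_rule R s)
  (X_class : seq_class X) (Y_class : seq_class Y)
  (X_stable : linearly_stable X) (Y_stable : linearly_stable Y)
  (X_shrinking : finitely_shrinking X) (Y_shrinking : finitely_shrinking Y)
  (X_zero_inv : finitely_zero_invariant X)
  (Y_zero_inv : finitely_zero_invariant Y)
  (n : nat) (Xs : 'I_n -> seq_rule R s)
  (Xs_choice : forall i, seq_rule_eq (Xs i) (unif X) \/
     seq_rule_eq (Xs i) X \/ seq_rule_eq (Xs i) (fdet X))
  (Xs_unif : exists k, seq_rule_eq (Xs k) (unif X))
  (Xs_compatible : compatible Xs Y) :
  symmetric_summing Xs Y /\
  forall (E : 'I_n -> banach R s) (F : banach R s),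
    summing E F Xs Y = summing E F Xs (unif Y).
Proof.
have [k kunif] := Xs_unif.
have key (E : 'I_n -> banach R s) (F : banach R s) (A : (forall i, E i) -> F) l
    (x : forall i, nat -> E i) :
    summing E F Xs Y A -> (forall i, carrier (fdet X) (E i) (x i)) ->
    carrier (unif X) (E l) (x l) -> carrier (unif Y) F (seq_apply A x).
  move=> [[Alin _] Asum]; apply: seq_apply_fdet_unif => // z zu.
  by apply: Asum => i; exact: unif_sub_choice (Xs_choice i) _ _ (zu i).
split=> [E F A sA|E F]; last first.
  apply/seteqP; split => A [cA sA]; split => // x cx; last by have [] := sA x cx.
  apply: (key _ _ _ k) => // [i|].
    exact: choice_sub_fdet (Xs_choice i) _ _ (cx i).
  by have [<- _] := kunif (E k).
have [cA _] := sA.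
split; first exact: cont_multilinear_symmetrization.
move=> x cx.
have -> : seq_apply (symmetrization A) x = ((n`!)%:R : scalar_field R s)^-1 *:
    \sum_(sigma : 'S_n) seq_apply A (fun i => x (sigma i)).
  by apply/funext => j; rewrite /seq_apply /symmetrization /GRing.scale /= fct_sumE.
apply: carrierZ => //; apply: carrier_sum => // sigma _.
(* The sequence from [X^u] now occupies position [sigma^-1 k]. *)
suff [] : carrier (unif Y) F (seq_apply A (fun i => x (sigma i))) by [].
apply: (key _ _ _ ((sigma^-1)%g k)) => // [i|].
  exact: choice_sub_fdet (Xs_choice (sigma i)) _ _ (cx (sigma i)).
by rewrite permKV; have [<- _] := kunif E.
Qed.
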